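(* Let $n$ be a positive integer and let $V_{8n} = \langle a, b \mid a^{2n} = b^{4} = 1,\ ba = a^{-1}b^{-1},\ b^{-1}a = a^{-1}b \rangle$. Let $\mathbb{F}$ be an algebraic extension of a prime field such that $\mathrm{char}(\mathbb{F})$ is either $0$ or an odd rational prime relatively prime to $n$. Then the dimension of the derivation algebra $\mathrm{Der}(\mathbb{F}V_{8n})$ over $\mathbb{F}$ is $6(n-1)$ if $n$ is even and $3(2n-1)$ if $n$ is odd, and a basis is $$\mathcal{B} = \{d_{(\bar{a}, \bar{b})} \mid (\bar{a}, \bar{b}) \in B_{1} \cup B_{2} \cup B_{3} \cup B_{4}\},$$ where $$\begin{aligned} B_{1} = \{& ((a^{-2k} - a^{2k})b,\,0),\ ((a^{2k-1} - a^{-(2k+1)})b,\, a^{2k} - a^{-2k}),\ ((a^{-2k} - a^{2k})b^{3},\,0),\\ & ((a^{2k-1} - a^{-(2k+1)})b^{3},\,(a^{2k} - a^{-2k}) b^{2}),\ (0,\,(a^{2k} - a^{-2k}) b),\ (0,\,(a^{2k} - a^{-2k}) b^{3}) \mid 1 \leq k \leq \lfloor \tfrac{n-1}{2} \rfloor\},\\ B_{2} = \{& ((a^{2k-2}-a^{-2k}b^{2})b,\, a^{2k-1} - a^{-(2k-1)}b^{2}),\ (0,\,(a^{2k-1} - a^{-(2k-1)}b^{2})b) \mid 1 \leq k \leq \lfloor \tfrac{n+1}{2} \rfloor\},\\ B_{3} = \{& ((a^{-2k} - a^{2k-2}b^{2})b,\, a^{-(2k-1)} - a^{2k-1}b^{2}),\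 (0,\,(a^{-(2k-1)} - a^{2k-1}b^{2})b) \mid 1 \leq k \leq \lceil \tfrac{n-1}{2} \rceil\},\\ B_{4} = \{& ((a^{-(2k-1)} - a^{2k-1}b^{2})b,\,0) \mid 1 \leq k \leq n\}. \end{aligned}$$
   Context: $V_{8n}$ has order $8n$ and $V_{8n} = \{a^{i}b^{j} \mid 0 \leq i \leq 2n-1,\ 0 \leq j \leq 3\}$; $\mathbb{F}V_{8n}$ is its group algebra over $\mathbb{F}$. A derivation of a ring $R$ is an additive map $d: R \to R$ with $d(xy) = d(x)y + x\,d(y)$ for all $x,y \in R$ (no linearity over a base field is required). $\mathrm{Der}(\mathbb{F}V_{8n})$ is the set of all derivations of the ring $\mathbb{F}V_{8n}$, an $\mathbb{F}$-vector space under pointwise operations. For $\bar a, \bar b \in \mathbb{F}V_{8n}$, $d_{(\bar{a},\bar{b})}$ denotes the $\mathbb{F}$-linear derivation $d$ of $\mathbb{F}V_{8n}$ with $d(a) = \bar{a}$ and $d(b) = \bar{b}$ (unique if it exists). The assertion that a set of such $d_{(\bar a,\bar b)}$ is a basis includes the assertion that these derivations exist for all the listed pairs. A set indexed by an empty range of $k$ is empty. *)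

(* Defs.v *)
From HB Require Import structures.
From mathcomp Require Import all_boot all_order all_fingroup all_algebra.
From mathcomp Require Import mathcomp_extra boolp classical_sets functions.
From mathcomp Require Import cardinality.

Set Implicit Arguments.
Unset Strict Implicit.
Unset Printing Implicit Defensive.
Import GRing.Theory.
Local Open Scope classical_set_scope.
Local Open Scope ring_scope.

Definition groupAlg (F : fieldType) (gT : finGroupType) : Type :=
  {ffun gT -> F^o}.

Section GroupAlgebra.
Variables (F : fieldType) (gT : finGroupType).
Local Notation A := (groupAlg F gT).

HB.instance Definition _ := Vector.on A.

Definition grpE (g : gT) : A := [ffun h => (h == g)%:R].

Definition galg_mul (x y : A) : A :=
  [ffun g => \sum_(h : gT) x h * y (h^-1 * g)%g].

Lemma galg_mulA : associative galg_mul.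
Proof.
move=> x y z; apply/ffunP => g; rewrite !ffunE.
under eq_bigr do rewrite ffunE mulr_sumr.
under [RHS]eq_bigr do rewrite ffunE mulr_suml.
rewrite [RHS]exchange_big /=; apply: eq_bigr => h _.
rewrite [RHS](reindex_inj (mulgI h)) /=; apply: eq_bigr => k _.
by rewrite mulrA mulKg invMg mulgA.
Qed.

Lemma galg_mul1l : left_id (grpE 1%g) galg_mul.
Proof.
move=> x; apply/ffunP => g; rewrite ffunE (bigD1 1%g) //= big1 ?addr0.
  by rewrite ffunE eqxx mul1r invg1 mul1g.
by move=> h /negPf h1; rewrite ffunE h1 mul0r.
Qed.

Lemma galg_mul1r : right_id (grpE 1%g) galg_mul.
Proof.
move=> x; apply/ffunP => g; rewrite ffunE (bigD1 g) //= big1 ?addr0.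
  by rewrite ffunE mulVg eqxx mulr1.
move=> h hg; rewrite ffunE -eq_mulVg1.
by rewrite (negPf hg) mulr0.
Qed.

Lemma galg_mulDl : left_distributive galg_mul +%R.
Proof.
move=> x y z; apply/ffunP => g; rewrite !ffunE -big_split /=.
by apply: eq_bigr => h _; rewrite ffunE mulrDl.
Qed.

Lemma galg_mulDr : right_distributive galg_mul +%R.
Proof.
move=> x y z; apply/ffunP => g; rewrite !ffunE -big_split /=.
by apply: eq_bigr => h _; rewrite ffunE mulrDr.
Qed.

Lemma galg_1neq0 : grpE 1%g != 0.
Proof.
by apply/eqP => /ffunP/(_ 1%g)/eqP; rewrite !ffunE eqxx oner_eq0.
Qed.

HB.instance Definition _ := GRing.Zmodule_isNzRing.Build A
  galg_mulA galg_mul1l galg_mul1r galg_mulDl galg_mulDr galg_1neq0.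

Lemma galg_scaleAl (c : F) (x y : A) : c *: (x * y) = (c *: x) * y.
Proof.
apply/ffunP => g; rewrite !ffunE scaler_sumr.
by apply: eq_bigr => h _; rewrite ffunE scalerAl.
Qed.

HB.instance Definition _ := GRing.Lmodule_isLalgebra.Build F A galg_scaleAl.

Lemma galg_scaleAr (c : F) (x y : A) : c *: (x * y) = x * (c *: y).
Proof.
apply/ffunP => g; rewrite !ffunE scaler_sumr.
by apply: eq_bigr => h _; rewrite ffunE scalerAr.
Qed.

HB.instance Definition _ := GRing.Lalgebra_isAlgebra.Build F A galg_scaleAr.

Lemma grpE1 : grpE 1%g = 1.
Proof. by []. Qed.

Lemma grpEM (g h : gT) : grpE (g * h)%g = grpE g * grpE h.
Proof.
apply/ffunP => k; rewrite !ffunE (bigD1 g) //= big1 ?addr0 => [|l /negPf lg].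
  by rewrite !ffunE eqxx mul1r -(inj_eq (mulgI g^-1%g)) mulKg.
by rewrite ffunE lg mul0r.
Qed.

End GroupAlgebra.
Arguments grpE F {gT} g%_g.

(* Only additivity is required of a derivation, not linearity over a base
   field. *)
Definition derivation (R : nzRingType) (d : R -> R) : Prop :=
  {morph d : x y / x + y} /\ forall x y, d (x * y) = d x * y + x * d y.

Definition Der (R : nzRingType) : set (R -> R) := [set d | derivation d].
Arguments Der R : clear implicits.

Lemma Der_submod (K : fieldType) (A : algType K) (c : K) (d e : A -> A) :
  Der A d -> Der A e -> Der A (c *: d + e).
Proof.
move=> [dD dM] [eD eM]; split => x y.
  by rewrite addrfctE scalrfctE dD eD scalerDr addrACA.
rewrite addrfctE scalrfctE dM eM mulrDl mulrDr scalerDr scalerAl scalerAr.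
by rewrite addrACA.
Qed.

(* Bases of a subspace U of a possibly infinite-dimensional V, given as sets of
   vectors. *)
Section Bases.
Variables (K : fieldType) (V : lmodType K).
Implicit Types (U S : set V).

Definition lin_indep S : Prop :=
  forall (s : seq V) (c : V -> K), uniq s -> (forall v, v \in s -> S v) ->
    \sum_(v <- s) c v *: v = 0 -> forall v, v \in s -> c v = 0.

Definition lin_span S : set V :=
  [set v | exists (s : seq V) (c : V -> K),
    (forall w, w \in s -> S w) /\ v = \sum_(w <- s) c w *: w].

Definition is_basis U S : Prop :=
  [/\ S `<=` U, lin_indep S & U `<=` lin_span S].

Definition has_dim U (m : nat) : Prop :=
  exists2 S, is_basis U S & (S #= `I_m)%card.

End Bases.

Definition V8n_relations (n : nat) (G : groupType) (a b : G) : Prop :=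
  [/\ a ^+ (2 * n) = 1, b ^+ 4 = 1,
      b * a = a^-1 * b^-1 & b^-1 * a = a^-1 * b]%g.

(* gT is the group presented by the relations above, with a and b the images of
   the two generators of the presentation: a and b generate gT, satisfy the
   relations, and every pair satisfying them in a group H is the image of
   (a, b) under a morphism. *)
Definition V8n_presentation (n : nat) (gT : finGroupType) (a b : gT) : Prop :=
  [/\ (<<[set a; b]>> = [set: gT])%SET%g,
      V8n_relations n a b &
      forall (H : groupType) (x y : H), V8n_relations n x y ->
        exists f : gT -> H,
          [/\ {morph f : g h / (g * h)%g}, f a = x & f b = y]].

Definition algebraic_over_prime_field (F : fieldType) : Prop :=
  (exists f : {rmorphism rat -> F}, forall x : F, algebraicOver f x) \/
  (exists2 p : nat, prime p &
    exists f : {rmorphism 'F_p -> F}, forall x : F, algebraicOver f x).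

Section Derivations.
Variables (F : fieldType) (gT : finGroupType) (a b : gT).
Local Notation A := (groupAlg F gT).
Local Notation "[ g ]" := (grpE F g).

(* The derivations denoted d_(p.1, p.2); there is at most one when a and b
   generate gT. *)
Definition d_pair (p : A * A) : set (A -> A) :=
  [set d | [/\ derivation d, scalable d, d [a] = p.1 & d [b] = p.2]].

Variable n : nat.

Definition B1 : set (A * A) :=
  \bigcup_(k in [set k : nat | (1 <= k <= (n - 1)./2)%N])
    [set (([a ^- (2 * k)] - [a ^+ (2 * k)]) * [b], 0);
         (([a ^+ (2 * k - 1)] - [a ^- (2 * k + 1)]) * [b],
          [a ^+ (2 * k)] - [a ^- (2 * k)]);
         (([a ^- (2 * k)] - [a ^+ (2 * k)]) * [b ^+ 3], 0);
         (([a ^+ (2 * k - 1)] - [a ^- (2 * k + 1)]) * [b ^+ 3],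
          ([a ^+ (2 * k)] - [a ^- (2 * k)]) * [b ^+ 2]);
         (0, ([a ^+ (2 * k)] - [a ^- (2 * k)]) * [b]);
         (0, ([a ^+ (2 * k)] - [a ^- (2 * k)]) * [b ^+ 3])].

Definition B2 : set (A * A) :=
  \bigcup_(k in [set k : nat | (1 <= k <= (n + 1)./2)%N])
    [set (([a ^+ (2 * k - 2)] - [a ^- (2 * k)] * [b ^+ 2]) * [b],
          [a ^+ (2 * k - 1)] - [a ^- (2 * k - 1)] * [b ^+ 2]);
         (0, ([a ^+ (2 * k - 1)] - [a ^- (2 * k - 1)] * [b ^+ 2]) * [b])].

(* uphalf m is the ceiling of m / 2. *)
Definition B3 : set (A * A) :=
  \bigcup_(k in [set k : nat | (1 <= k <= uphalf (n - 1))%N])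
    [set (([a ^- (2 * k)] - [a ^+ (2 * k - 2)] * [b ^+ 2]) * [b],
          [a ^- (2 * k - 1)] - [a ^+ (2 * k - 1)] * [b ^+ 2]);
         (0, ([a ^- (2 * k - 1)] - [a ^+ (2 * k - 1)] * [b ^+ 2]) * [b])].

Definition B4 : set (A * A) :=
  \bigcup_(k in [set k : nat | (1 <= k <= n)%N])
    [set (([a ^- (2 * k - 1)] - [a ^+ (2 * k - 1)] * [b ^+ 2]) * [b], 0)].

Definition Bpairs : set (A * A) := B1 `|` B2 `|` B3 `|` B4.

End Derivations.
Arguments d_pair F {gT} a b p.
Arguments B1 F {gT} a b n.
Arguments B2 F {gT} a b n.
Arguments B3 F {gT} a b n.
Arguments B4 F {gT} a b n.
Arguments Bpairs F {gT} a b n.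

(* Main.v *)
Require Import Defs.
From HB Require Import structures.
From mathcomp Require Import all_boot all_order all_fingroup all_algebra.
From mathcomp Require Import mathcomp_extra boolp classical_sets functions.
From mathcomp Require Import cyclic cardinality zify.
Set Implicit Arguments.
Unset Strict Implicit.
Unset Printing Implicit Defensive.
Import GRing.Theory.
Local Open Scope classical_set_scope.
Local Open Scope ring_scope.

(* Since F is algebraic over a perfect prime field, a derivation of the F-algebra
   FG kills the scalars, hence is F-linear; as |G| is invertible in F, it is then
   inner, by averaging.  Let z = b^2 and N = <a, z>, an abelian subgroup of index
   2 on which conjugation by b is the involution a |-> a^-1 z, z |-> z, and put
   E(m) = m - b m b^-1 for m in N.  The commutators with m and with m b correspond
   to the pairs -(0, E(m) b) and (E(a m) b, 0) - (a^-1 E(m z) b, E(m z)).  Applying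
   the second one to m and to b m b^-1 and using that 2 is invertible shows that
   (E(m) b, 0) and (a^-1 E(m) b, E(m)) come from derivations too.  So the pairs of
   the three shapes span, and letting m run through representatives of the
   two-element orbits of the involution makes them independent. *)

(** * Derivations kill the scalars that are algebraic over the prime field *)

Section DerivationTheory.
Variables (K : fieldType) (A : algType K) (d : A -> A).
Hypothesis dD : derivation d.

Lemma der0 : d 0 = 0.
Proof. by apply: (addrI (d 0)); rewrite -dD.1 !addr0. Qed.

Lemma derN x : d (- x) = - d x.
Proof. by apply: (addrI (d x)); rewrite -dD.1 !subrr der0. Qed.

Lemma derB x y : d (x - y) = d x - d y.
Proof. by rewrite dD.1 derN. Qed.

Lemma der1 : d 1 = 0.
Proof.
have := dD.2 1 1; rewrite !mulr1 mul1r => /eqP.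
by rewrite -subr_eq0 opprD addrA subrr sub0r oppr_eq0 => /eqP.
Qed.

Lemma derMn x n : d (x *+ n) = d x *+ n.
Proof. by elim: n => [|n IHn]; rewrite ?mulr0n ?der0 // !mulrS dD.1 IHn. Qed.

Lemma der_nat n : d n%:R = 0.
Proof. by rewrite derMn der1 mul0rn. Qed.

(** Chain rule: when [d] kills the coefficients, only the differentiation of the argument survives.
    The induction writes the polynomial as q X + e and applies the Leibniz rule to q(c) c. *)
Lemma der_horner (p : {poly K}) (c : K) :
    (forall i, d (p`_i)%:A = 0) -> d (p.[c])%:A = p^`().[c] *: d c%:A.
Proof.
elim/poly_ind: p => [|p e IHp] coefd.
  by rewrite deriv0 !horner0 !scale0r der0.
have dp i : d (p`_i)%:A = 0.
  by have := coefd i.+1; rewrite coefD coefMX coefC /= addr0.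
have de : d e%:A = 0 by have := coefd 0; rewrite coefD coefMX coefC /= add0r.
rewrite derivD derivM derivX derivC mulr1 addr0 !hornerE scalerDl dD.1 de addr0.
rewrite [(_ * c)%:A](_ : _ = p.[c]%:A * c%:A); last by rewrite mulr_algl scalerA.
rewrite dD.2 IHp // mulr_algl -scalerAl mulr_algr scalerA.
by rewrite scalerDl.
Qed.

Lemma der_int (m : int) : d m%:~R = 0.
Proof.
case: m => m; first exact: der_nat.
by rewrite NegzE mulrNz derN -pmulrn der_nat oppr0.
Qed.

(** Applying [d] to p(c) = 0 gives p'(c) d(c) = 0, where p'(c) is invertible. *)
Lemma der_const_root (p : {poly K}) (c : K) :
    (forall i, d (p`_i)%:A = 0) -> root p c -> p^`().[c] != 0 -> d c%:A = 0.
Proof.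
move=> coefd /eqP pc0 dpc; apply: (scalerI dpc).
by rewrite -der_horner // pc0 scale0r der0 scaler0.
Qed.

(** Clear the denominator: [d] kills the integers, and [denq q] stays invertible in [K] because [f]
    is injective. *)
Lemma der_ratr (f : {rmorphism rat -> K}) (q : rat) : d (f q)%:A = 0.
Proof.
have fint (m : int) : f m%:~R = m%:~R := rmorph_int f m.
have nz : (denq q)%:~R != 0 :> K by rewrite -fint fmorph_eq0 intr_eq0 denq_neq0.
have dint (m : int) : d (m%:~R)%:A = 0 by rewrite scaler_int der_int.
apply: (scalerI nz); rewrite scaler0 -[LHS]mulr_algl.
have := dint (numq q); rewrite -fint numqE rmorphM /= fint.
rewrite [(_ * _)%:A](_ : _ = (denq q)%:~R%:A * (f q)%:A).
  by rewrite dD.2 dint mul0r add0r.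
by rewrite mulr_algl scalerA mulrC.
Qed.

(** Induction on the size of an annihilating polynomial stands in for minimality: if p'(c) = 0, then
    p' is a smaller annihilator, and it is nonzero in characteristic 0. *)
Lemma der_algebraic_rat (f : {rmorphism rat -> K}) (c : K) :
  algebraicOver f c -> d c%:A = 0.
Proof.
case=> p; have [m] := ubnP (size p); elim: m => // m IHm in p *.
rewrite ltnS => sp p0 pc0.
have [dpc0|dpc] := eqVneq (map_poly f p)^`().[c] 0; last first.
  by apply: der_const_root pc0 dpc => i; rewrite coef_map /= der_ratr.
apply: (IHm p^`()); last by rewrite /root -deriv_map dpc0.
  by apply: leq_trans sp; apply: lt_size_deriv.
(* A nonzero constant has no root, so p has positive degree, and the top coefficient of p' is that
   degree times the leading coefficient of p. *)
have sp1 : (1 < size p)%N.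
  rewrite ltnNge; apply/negP => /size1_polyC pE; move: p0 pc0.
  rewrite pE polyC_eq0 map_polyC /= rootC fmorph_eq0 => /negPf ->.
  by [].
apply/eqP => /polyP/(_ (size p).-2); rewrite coef0 coef_deriv.
case sE: (size p) sp1 => [|[|s]] //= _.
have := p0; rewrite -lead_coef_eq0 lead_coefE sE /= => /negPf lp.
by move/eqP; rewrite Num.Theory.mulrn_eq0 lp.
Qed.

(** An algebraic c satisfies c^(p^k) = c for some k > 0, so it is a root of X^(p^k) - X, whose
    derivative is the constant -1. *)
Lemma der_algebraic_Fp (p : nat) (f : {rmorphism 'F_p -> K}) (c : K) :
  prime p -> algebraicOver f c -> d c%:A = 0.
Proof.
move=> pr_p [q q0 qc0].
have pcharK : p \in [pchar K].
  by rewrite (fmorph_pchar f) pchar_Fp.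
(* The remainders of X^(p^i) modulo q lie in a finite space, so two of them coincide; evaluation at
   the root c then gives c^(p^i) = c^(p^j). *)
pose g i := poly_rV (d := size q) ('X^(p ^ i) %% q).
have [i [j [lij gij]]] : exists i j, (i < j)%N /\ g i = g j.
  pose N := #|{: 'rV['F_p]_(size q)}|.
  have /injectivePn[i [j nij gij]] : ~~ injectiveb (fun i : 'I_N.+1 => g i).
    by apply/negP => /injectiveP/leq_card; rewrite card_ord ltnn.
  case: (ltngtP i j) => [lij|lji|/ord_inj eij].
  - by exists i, j.
  - by exists j, i.
  - by rewrite eij eqxx in nij.
have evq k : c ^+ k = (map_poly f ('X^k %% q)).[c].
  have /(congr1 (fun r => (map_poly f r).[c])) := divp_eq 'X^k q.
  rewrite rmorphD rmorphM /= !hornerE map_polyXn hornerXn (eqP qc0) mulr0 add0r.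
  by [].
have cij : c ^+ (p ^ i) = c ^+ (p ^ j).
  have gK k : rVpoly (g k) = 'X^(p ^ k) %% q.
    by apply: poly_rV_K; rewrite ltnW // ltn_modp.
  by rewrite !evq -!gK gij.
have FrobE k x : iter k (pFrobenius_aut pcharK) x = x ^+ (p ^ k).
  elim: k => [|k IHk]; first by rewrite expn0 expr1.
  by rewrite iterS IHk pFrobenius_autE -exprM -expnSr.
have injFrob k : injective (iter k (pFrobenius_aut pcharK)).
  by elim: k => [|k IHk] x y //= /fmorph_inj /IHk.
(* Injectivity of the iterated Frobenius cancels i of the j iterations. *)
have cE : c = c ^+ (p ^ (j - i)).
  apply: (injFrob i); rewrite !FrobE cij -exprM -expnD subnK //.
  exact: ltnW.
have pA : p%:R = 0 :> K by apply: pcharf0.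
have : root ('X^(p ^ (j - i)) - 'X) c by rewrite /root !hornerE -cE subrr.
move/der_const_root; apply.
  move=> k; rewrite coefB coefXn coefX.
  rewrite scalerBl derB !scaler_nat !der_nat.
  by rewrite subrr.
rewrite derivB derivXn derivX !hornerE hornerMn -(subnSK lij) expnS.
rewrite mulrnA -[_ *+ p]mulr_natr pA mulr0 mul0rn sub0r oppr_eq0.
exact: oner_neq0.
Qed.

Lemma der_scalable : algebraic_over_prime_field K -> scalable d.
Proof.
move=> algK c x; have dc0 : d c%:A = 0.
  case: algK => [[f algf]|[p pr_p [f algf]]].
    exact: der_algebraic_rat (algf c).
  exact: der_algebraic_Fp (algf c).
by rewrite -mulr_algl dD.2 dc0 mul0r add0r mulr_algl.
Qed.

End DerivationTheory.

(** * Independence through dual functionals, and spans of finite sequences *)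

Section FiniteBases.
Variables (K : fieldType) (V : lmodType K).
Implicit Types (S U : set V) (s : seq V).

(** The functional dual to [v], applied to a vanishing combination, leaves only the coefficient of
    [v]. *)
Lemma lin_indep_dual S :
    (forall v, S v -> exists phi : V -> K,
       [/\ forall x y, phi (x + y) = phi x + phi y,
           forall k x, phi (k *: x) = k * phi x, phi v = 1 &
           forall w, S w -> w != v -> phi w = 0]) ->
  lin_indep S.
Proof.
move=> dualS s c us sS s0 v vs.
have [phi [phiD phiZ phiv phiN]] := dualS v (sS v vs).
have phi0 : phi 0 = 0 by rewrite -(scale0r 0) phiZ mul0r.
have := congr1 phi s0; rewrite phi0 (bigD1_seq v) //= phiD phiZ phiv mulr1.
rewrite (_ : phi _ = 0) ?addr0 // big_seq_cond.
apply: (big_ind (fun x => phi x = 0)) => // [x y px py|w /andP[ws wv]].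
  by rewrite phiD px py addr0.
by rewrite phiZ phiN ?mulr0 //; apply: sS.
Qed.

Definition seq_span s : set V := [set v | exists c, v = \sum_(w <- s) c w *: w].

Lemma seq_span_lin s : seq_span s `<=` lin_span [set` s].
Proof. by move=> v [c ->]; exists s, c. Qed.

Lemma seq_span_linear s k v w :
  seq_span s v -> seq_span s w -> seq_span s (k *: v + w).
Proof.
move=> [c ->] [e ->]; exists (fun x => k * c x + e x).
rewrite scaler_sumr -big_split /=; apply: eq_bigr => x _.
by rewrite scalerDl scalerA.
Qed.

Lemma seq_span_mem s v : uniq s -> v \in s -> seq_span s v.
Proof.
move=> us vs; exists (fun w => (w == v)%:R).
rewrite (bigD1_seq v) //= eqxx scale1r big1 ?addr0 // => w /negPf ->.
by rewrite scale0r.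
Qed.

Lemma seq_span0 s : seq_span s 0.
Proof.
by exists (fun=> 0); rewrite big1 // => w _; rewrite scale0r.
Qed.

End FiniteBases.

(** * Inner derivations of a group algebra *)

Section InnerDerivations.
Variables (F : fieldType) (gT : finGroupType).
Local Notation A := (groupAlg F gT).
Local Notation "[ g ]" := (grpE F g).

(** With this order of the factors, the averaging element of [derivation_inner] implements [d]
    without a sign. *)
Definition ad (u x : A) : A := x * u - u * x.

Lemma ad_derivation u : derivation (ad u).
Proof.
split=> x y; rewrite /ad; first by rewrite mulrDl mulrDr opprD addrACA.
by rewrite mulrBl mulrBr !mulrA [RHS]addrC addrA subrK.
Qed.

Lemma ad_scalable u : scalable (ad u).
Proof. by move=> k x; rewrite /ad -scalerAl -scalerAr scalerBr. Qed.

Lemma groupAlg_sum (x : A) : x = \sum_g x g *: [g].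
Proof.
apply/ffunP => h; rewrite sum_ffunE (bigD1 h) //= !ffunE eqxx big1.
  by rewrite addr0 [RHS]mulr1.
by move=> g gh; rewrite !ffunE eq_sym (negPf gh) [LHS]mulr0.
Qed.

Lemma grpEMl (x : A) g h : (x * [g]) h = x (h * g^-1)%g.
Proof.
rewrite ffunE (bigD1 (h * g^-1)%g) //= ffunE invMg invgK -mulgA mulVg mulg1.
rewrite eqxx mulr1 big1 ?addr0 // => k hk; rewrite ffunE.
case: eqP => [gE|]; last by rewrite mulr0.
by case/eqP: hk; rewrite -gE invMg invgK mulKVg.
Qed.

Lemma grpEMr (x : A) g h : ([g] * x) h = x (g^-1 * h)%g.
Proof.
rewrite ffunE (bigD1 g) //= ffunE eqxx mul1r big1 ?addr0 // => k /negPf gk.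
by rewrite ffunE gk mul0r.
Qed.

Lemma scalable_sum (d : A -> A) (x : A) : derivation d -> scalable d ->
  d x = \sum_g x g *: d [g].
Proof.
move=> dD dZ; rewrite {1}[x]groupAlg_sum (big_morph d dD.1 (der0 dD)).
by apply: eq_bigr => g _; rewrite dZ.
Qed.

(* The average of the elements [g^-1] d([g]) implements d. *)
Lemma derivation_inner (d : A -> A) : derivation d -> scalable d ->
  #|gT|%:R != 0 :> F -> exists u, d = ad u.
Proof.
move=> dD dZ nz; pose w := \sum_g [g^-1] * d [g].
have wE h : #|gT|%:R *: d [h] = [h] * w - w * [h].
  (* Reindexing by g -> g h and the Leibniz rule split the sum into a conjugate of [w] and [#|gT|]
     copies of one term. *)
  have wE : w = [h^-1] * w * [h] + #|gT|%:R *: ([h^-1] * d [h]).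
    rewrite {1}/w (reindex_inj (mulIg h)) /= mulr_sumr mulr_suml.
    rewrite scaler_nat -sumr_const -big_split /=; apply: eq_bigr => g _.
    rewrite invMg !grpEM dD.2 mulrDr !mulrA; congr (_ + _).
    by rewrite -[_ * [g^-1] * [g]]mulrA -grpEM mulVg grpE1 mulr1.
  rewrite {1}wE mulrDr !mulrA -grpEM mulgV grpE1 mul1r addrC addKr.
  by rewrite -scalerAr mulrA -grpEM mulgV grpE1 mul1r.
exists (#|gT|%:R^-1 *: w); apply/funext => x.
rewrite scalable_sum // [RHS]scalable_sum; first last.
- exact: ad_scalable.
- exact: ad_derivation.
apply: eq_bigr => g _; congr (_ *: _); apply: (scalerI nz); rewrite wE.
by rewrite /ad -scalerAr -scalerAl -scalerBr scalerA mulfV // scale1r.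
Qed.

Variables (a b : gT).

Lemma d_pairD (p q : A * A) k d e : d_pair F a b p d -> d_pair F a b q e ->
  d_pair F a b (k *: p + q) (k *: d + e).
Proof.
move=> [dD dZ da db] [eD eZ ea eb]; split=> //=.
- exact: Der_submod.
- move=> c x; rewrite !addrfctE !scalrfctE dZ eZ scalerDr !scalerA.
  by rewrite mulrC.
- by rewrite addrfctE scalrfctE da ea.
- by rewrite addrfctE scalrfctE db eb.
Qed.

Lemma d_pair0 : d_pair F a b 0 0.
Proof.
have z x : (0 : groupAlg F gT -> groupAlg F gT) x = 0 by [].
split=> //; last by move=> c x; rewrite !z scaler0.
by split=> x y; rewrite !z ?addr0 // mul0r mulr0 addr0.
Qed.

Lemma d_pair_ad u : d_pair F a b (ad u [a], ad u [b]) (ad u).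
Proof. by split=> //; [exact: ad_derivation | exact: ad_scalable]. Qed.

Lemma d_pair_fun p q d : d_pair F a b p d -> d_pair F a b q d -> p = q.
Proof.
by case: p q => [p1 p2] [q1 q2] [_ _ /= <- <-] [_ _ /= <- <-].
Qed.

(** The group elements on which [d] and [e] agree form a subgroup containing both generators;
    scalability extends the agreement to the whole algebra. *)
Lemma d_pair_inj p d e : (<<[set a; b]>> = [set: gT])%SET%g ->
  d_pair F a b p d -> d_pair F a b p e -> d = e.
Proof.
move=> genG [dD dZ da db] [eD eZ ea eb].
pose H := [set g | d [g] == e [g]]%SET.
have gH : group_set H.
  apply/group_setP; split; first by rewrite inE grpE1 (der1 dD) (der1 eD).
  move=> g h; rewrite !inE => /eqP dg /eqP dh.
  by rewrite grpEM dD.2 eD.2 dg dh.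
have sGH : [set: gT]%SET \subset H.
  rewrite -genG (gen_subG _ (group gH)) finset.subUset !finset.sub1set !inE.
  by rewrite da db ea eb !eqxx.
apply/funext => x; rewrite scalable_sum // [RHS]scalable_sum //.
apply: eq_bigr => g _; have /(fintype.subsetP sGH) : g \in [set: gT]%SET by [].
by rewrite inE => /eqP ->.
Qed.

End InnerDerivations.

(* The right regular action of V_8n on the normal forms a^i z^j b^l, z = b^2. *)
Section RegularAction.
Variable n : nat.
Hypothesis n_gt0 : (0 < n)%N.
Local Notation T := ('Z_(2 * n) * 'Z_2 * bool)%type.

(** The branch [l = true] reflects b a = a^-1 z b: moving a to the left of b inverts it and adds a
    factor z. *)
Definition act_a (t : T) : T :=
  let: (i, j, l) := t in if l then (i - 1, j + 1, true) else (i + 1, j, false).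

Definition act_b (t : T) : T :=
  let: (i, j, l) := t in if l then (i, j + 1, false) else (i, j, true).

Lemma act_a_inj : injective act_a.
Proof.
pose inv (t : T) : T :=
  let: (i, j, l) := t in if l then (i + 1, j - 1, true) else (i - 1, j, false).
by apply: (can_inj (g := inv)) => [[[i j] []]]; rewrite /= ?subrK ?addrK.
Qed.

Lemma act_b_inj : injective act_b.
Proof.
pose inv (t : T) : T :=
  let: (i, j, l) := t in if l then (i, j, false) else (i, j - 1, true).
by apply: (can_inj (g := inv)) => [[[i j] []]]; rewrite /= ?addrK.
Qed.

Definition perm_a := perm act_a_inj.
Definition perm_b := perm act_b_inj.

Lemma perm_aX k i j l : (perm_a ^+ k)%g (i, j, l) =
  if l then (i - k%:R, j + k%:R, true) else (i + k%:R, j, false).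
Proof.
elim: k => [|k IHk]; first by rewrite expg0 perm1 subr0 !addr0; case: l.
rewrite expgSr permM IHk permE; case: l {IHk} => /=.
  by rewrite -!natr1 opprD !addrA.
by rewrite -natr1 addrA.
Qed.

Lemma Z2_add2 (j : 'Z_2) : j + 1 + 1 = j.
Proof. by apply/val_inj; case: j => [[|[|]]]. Qed.

Lemma perm_b2 i j l : (perm_b ^+ 2)%g (i, j, l) = (i, j + 1, l).
Proof. by rewrite expgS permM expg1 !permE; case: l. Qed.

Lemma perm_b2X k i j l : (perm_b ^+ 2 ^+ k)%g (i, j, l) = (i, j + k%:R, l).
Proof.
elim: k i j l => [|k IHk] i j l; first by rewrite expg0 perm1 addr0.
by rewrite expgSr permM IHk perm_b2 -natr1 addrA.
Qed.

Lemma perm_relations : V8n_relations n perm_a perm_b.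
Proof.
have b4 : (perm_b ^+ 4 = 1)%g.
  apply/permP => [[[i j] l]].
  by rewrite (expgM _ 2 2) perm_b2X perm1 (_ : 2%:R = 1 + 1) // addrA Z2_add2.
have a2n : (perm_a ^+ (2 * n) = 1)%g.
  (* Since n > 0, the modulus 2n exceeds 1, so ['Z_(2 * n)] is truly the ring of integers modulo
     2n. *)
  have Z0 : (2 * n)%:R = 0 :> 'Z_(2 * n).
    by apply: pchar_Zp; case: n n_gt0 => // m _; rewrite mulnS.
  have Z20 : (2 * n)%:R = 0 :> 'Z_2 by rewrite natrM (pchar_Zp (p := 2)) ?mul0r.
  apply/permP => [[[i j] l]]; rewrite perm_aX perm1 Z0 Z20 subr0 !addr0.
  by case: l.
have ba : (perm_b * perm_a = perm_a^-1 * perm_b^-1)%g.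
  apply: (mulgI perm_a); rewrite mulKVg; apply: (mulIg perm_b).
  rewrite mulVg; apply/permP => [[[i j] l]]; rewrite !permM perm1 !permE.
  by case: l => /=; rewrite ?subrK ?addrK Z2_add2.
have bVa : (perm_b^-1 * perm_a = perm_a^-1 * perm_b)%g.
  apply: (mulgI perm_a); rewrite mulKVg.
  have -> : (perm_b^-1 = perm_b ^+ 3)%g.
    by apply: (mulgI perm_b); rewrite mulgV -expgS b4.
  apply/permP => [[[i j] l]]; rewrite !permM !permE /=.
  by case: l => /=; rewrite ?subrK ?addrK ?Z2_add2.
by split.
Qed.

End RegularAction.

(** * The abelian subgroup [N8], normal forms and the transversal [R8] *)

Section V8nGroup.
Variables (n : nat) (V : finGroupType) (a b : V).
Hypothesis n_gt0 : (0 < n)%N.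
Hypothesis presV : V8n_presentation n a b.
Local Open Scope group_scope.

(** As [g ^ h] stands for h^-1 g h, this is b g b^-1. *)
Definition bconj (g : V) : V := g ^ b^-1.
Local Notation z := (b ^+ 2).
Definition N8 : {group V} := (<[a]> <*> <[z]>)%G.

Let relV : V8n_relations n a b. Proof. by case: presV. Qed.

Lemma expa2n : a ^+ (2 * n) = 1. Proof. by case: relV. Qed.
Lemma expz2 : z * z = 1. Proof. by rewrite -expgD; case: relV. Qed.
Lemma zV : z^-1 = z. Proof. by apply: (mulgI z); rewrite mulgV expz2. Qed.

Lemma bconj_mul g : b * g = bconj g * b.
Proof. by rewrite /bconj conjgE invgK !mulgA mulgKV. Qed.

Lemma bconjM g h : bconj (g * h) = bconj g * bconj h. Proof. exact: conjMg. Qed.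
Lemma bconjX g k : bconj (g ^+ k) = bconj g ^+ k. Proof. exact: conjXg. Qed.
Lemma bconjV g : bconj g^-1 = (bconj g)^-1. Proof. exact: conjVg. Qed.

Lemma bconjb : bconj b = b.
Proof. by apply: (mulIg b); rewrite -bconj_mul. Qed.

Lemma bconj_a : bconj a = a^-1 * z.
Proof.
apply: (mulIg b); rewrite -bconj_mul; have [_ b4 -> _] := relV.
rewrite -mulgA; congr (_ * _); apply: (mulgI b).
by rewrite mulgV -expgSr -expgS b4.
Qed.

(** The first relation gives b a b^-1 = a^-1 z, the second b a^-1 b^-1 = a z. Inverting the former
    and comparing yields z a = a z. *)
Lemma commute_az : commute a z.
Proof.
have ba := bconj_a.
have sigVa : bconj a^-1 = a * z.
  apply: (mulIg b); rewrite -bconj_mul -mulgA -expgSr.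
  have [_ b4 _ ba'] := relV.
  have aE : a = b * a^-1 * b by rewrite -mulgA -ba' mulKVg.
  by rewrite [in RHS]aE -mulgA -expgS b4 mulg1.
by rewrite /commute -sigVa bconjV bconj_a invMg invgK zV.
Qed.

Lemma cza : <[z]> \subset 'C(<[a]>).
Proof. by rewrite cent_cycle cycle_subG; apply/cent1P/commute_sym/commute_az. Qed.

Lemma N8P g : reflect (exists i j, g = a ^+ i * z ^+ j) (g \in N8).
Proof.
rewrite /= cent_joinEr ?cza //; apply: (iffP mulsgP).
  by case=> x y /cycleP[i ->] /cycleP[j ->] ->; exists i, j.
by case=> i [j ->]; exists (a ^+ i) (z ^+ j); rewrite ?mem_cycle.
Qed.

Lemma N8_abelian : abelian N8.
Proof. by rewrite abelianY !cycle_abelian cza. Qed.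

Lemma a_N8 : a \in N8.
Proof. by apply/N8P; exists 1%N, 0%N; rewrite expg0 mulg1 expg1. Qed.

Lemma z_N8 : z \in N8.
Proof. by apply/N8P; exists 0%N, 1%N; rewrite expg0 mul1g expg1. Qed.

Lemma N8C g h : g \in N8 -> h \in N8 -> g * h = h * g.
Proof. by move=> gN hN; apply: (centsP N8_abelian). Qed.

Lemma bconj_N8 g : g \in N8 -> bconj g \in N8.
Proof.
case/N8P=> i [j ->]; rewrite bconjM !bconjX bconj_a bconjb.
apply: groupM; apply: groupX; last exact: z_N8.
by apply: groupM; [rewrite groupV; exact: a_N8 | exact: z_N8].
Qed.

(** Conjugating twice by b is conjugating by z, which lies in the abelian group [N8]. *)
Lemma bconjK g : g \in N8 -> bconj (bconj g) = g.
Proof.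
move=> gN; rewrite /bconj -conjgM -invMg -[b * b]/z zV conjgE zV N8C ?z_N8 //.
  by rewrite -mulgA expz2 mulg1.
by apply: groupM; rewrite ?z_N8.
Qed.

Lemma bconj_nf i j : bconj (a ^+ i * z ^+ j) = a ^- i * z ^+ (i + j).
Proof.
rewrite bconjM !bconjX bconj_a bconjb expgMn; last first.
  by apply: N8C; rewrite ?groupV ?a_N8 ?z_N8.
by rewrite expgVn expgD mulgA.
Qed.

Lemma V8n_mul : N8 * <[b]> = [set: V]%SET.
Proof.
have nNb : b \in 'N(N8).
  rewrite -groupV inE; apply/fintype.subsetP => _ /imsetP[x xN ->].
  exact: bconj_N8.
apply/eqP; rewrite finset.eqEsubset finset.subsetT.
have [<- _ _] := presV; rewrite -norm_joinEr ?cycle_subG //.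
rewrite gen_subG finset.subUset !finset.sub1set.
by rewrite mem_gen ?inE ?a_N8 // mem_gen // !inE cycle_id orbT.
Qed.

(** The orders of a, z and b divide 2n, 2 and 4. This crude multiple of the order suffices, as it
    only serves to make [#|V|] invertible in the field. *)
Lemma card_V8n_dvd : (#|V| %| 16 * n)%N.
Proof.
have dvdM (G H : {group V}) : (#|(G * H)%g| %| #|G| * #|H|)%N.
  by rewrite mul_cardG dvdn_mulr.
rewrite -cardsT -V8n_mul; apply: dvdn_trans (dvdM _ _) _.
have -> : (16 * n = 2 * n * 2 * 4)%N by rewrite -mulnA mulnAC.
have dvdX (g : V) k : g ^+ k = 1 -> (#|<[g]>| %| k)%N.
  by move=> gk; rewrite -orderE order_dvdn gk.
apply: dvdn_mul; last by apply: dvdX; case: relV.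
rewrite /= cent_joinEr ?cza //; apply: dvdn_trans (dvdM _ _) _.
by apply: dvdn_mul; apply: dvdX; [exact: expa2n | exact: expz2].
Qed.

Lemma V8n_cosets g : g \in N8 \/ g * b^-1 \in N8.
Proof.
have : g \in N8 * <[b]> by rewrite V8n_mul inE.
move/mulsgP => [x _ xN /cycleP[k ->] ->].
have -> : b ^+ k = z ^+ k./2 * b ^+ odd k.
  by rewrite -expgM -expgD mulnC addnC muln2 odd_double_half.
rewrite mulgA; case: (odd k) => /=; [right|left].
  by rewrite expg1 mulgK groupM // groupX ?z_N8.
by rewrite mulg1 groupM // groupX ?z_N8.
Qed.

(** The universal property maps V to the permutations of the regular action; the image of the base
    point (0, 0, false) under a normal form displays its exponents. *)
Lemma nf_repr : exists f : V -> 'Z_(2 * n) * 'Z_2 * bool,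
  forall i j (l : bool), f (a ^+ i * z ^+ j * b ^+ l) = (i%:R, j%:R, l)%R.
Proof.
have [_ _ /(_ _ _ _ (perm_relations n_gt0)) [f [fM fa fb]]] := presV.
have f1 : f 1 = 1 by apply: (mulgI (f 1)); rewrite -fM !mulg1.
have fX g k : f (g ^+ k) = f g ^+ k.
  by elim: k => [|k IHk]; rewrite ?expg0 // !expgS fM IHk.
exists (fun g => f g (0, 0, false)%R) => i j l.
rewrite !fM !fX fa fb !permM perm_aX perm_b2X add0r add0r.
by case: l; rewrite ?expg1 ?expg0 ?perm1 // permE.
Qed.

Lemma nf_inj i j i' j' : a ^+ i * z ^+ j = a ^+ i' * z ^+ j' ->
  i = i' %[mod 2 * n] /\ odd j = odd j'.
Proof.
have [f fE] := nf_repr => e.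
have fij := fE i j false; rewrite e fE in fij.
have ei := congr1 (fun t => val t.1.1) fij.
have ej := congr1 (fun t => val t.1.2) fij.
have n2_gt1 : (1 < 2 * n)%N by case: n n_gt0 => // m _; rewrite mulnS.
rewrite /= !val_Zp_nat // in ej; rewrite /= !val_Zp_nat // in ei.
by split; last by move: ej; rewrite !modn2; do 2!case: (odd _).
Qed.

Lemma b_notin_N8 : b \notin N8.
Proof.
have [f fE] := nf_repr; apply/negP => /N8P[i [j bE]].
have := fE i j false; have := fE 0%N 0%N true.
by rewrite expg1 !expg0 !mul1g mulg1 -bE => ->.
Qed.

Lemma nf_mod i j : a ^+ i * z ^+ j = a ^+ (i %% (2 * n)) * z ^+ odd j.
Proof. by rewrite (expg_mod _ expa2n) -modn2 (@expg_mod _ 2 j z expz2). Qed.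

Lemma N8_repr g : g \in N8 ->
  exists i (j : bool), (i < 2 * n)%N /\ g = a ^+ i * z ^+ j.
Proof.
case/N8P=> i [j ->]; exists (i %% (2 * n))%N, (odd j).
by rewrite -nf_mod ltn_mod muln_gt0 n_gt0.
Qed.

(** Conjugation by b sends a^i z^j to a^-i z^(i+j). For odd i it flips j, and j = 0 is selected; for
    even i it keeps j and negates i, and 0 < i < n is selected. The fixed points have i = 0, or i =
    n with n even. *)
Definition R8_cond (i : nat) (j : bool) := if odd i then ~~ j else (0 < i < n)%N.

(* A transversal of the two-element orbits of [bconj] on [N8]. *)
Definition R8 : {set V} :=
  [set a ^+ p.1 * z ^+ p.2 | p : 'I_(2 * n) * bool & R8_cond p.1 p.2]%SET.

Lemma R8E i (j : bool) :
  (i < 2 * n)%N -> (a ^+ i * z ^+ j \in R8) = R8_cond i j.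
Proof.
move=> i2n; apply/imsetP/idP => [[[i' j'] /= c' /nf_inj[]]|c].
  rewrite !modn_small // => -> jj; move: c'; rewrite inE /=.
  by case: j j' jj => [] [].
by exists (Ordinal i2n, j); rewrite ?inE.
Qed.

Lemma expaV i : (i <= 2 * n)%N -> a ^- i = a ^+ (2 * n - i).
Proof.
by move=> i2n; apply: (mulIg (a ^+ i)); rewrite mulVg -expgD subnK // expa2n.
Qed.

Lemma R8_N8 : R8 \subset N8.
Proof.
by apply/fintype.subsetP => _ /imsetP[[i j] _ ->]; apply/N8P; exists i, j.
Qed.

Lemma bconj_nfE i j : (i < 2 * n)%N ->
  bconj (a ^+ i * z ^+ j) = a ^+ (2 * n - i) * z ^+ odd (i + j).
Proof.
move=> i2n; rewrite bconj_nf expaV 1?ltnW //.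
by rewrite -modn2 (@expg_mod _ 2 (i + j) z expz2).
Qed.

Lemma R8_cover m : m \in N8 -> [\/ bconj m = m, m \in R8 | bconj m \in R8].
Proof.
case/N8_repr => i [j [i2n ->]]; rewrite R8E // bconj_nfE //.
(* The exponent 0 is split off because 2n - i is a reduced exponent only for i > 0. *)
case: (posnP i) => [->|i_gt0].
  by apply: Or31; rewrite subn0 expa2n expg0 add0n oddb.
rewrite R8E; last by lia.
have odd2n : odd (2 * n - i) = odd i by lia.
rewrite /R8_cond odd2n; case: ifP => oi.
  by rewrite oddD oi oddb; case: j => /=; [apply: Or33 | apply: Or32].
case: (ltngtP i n) => [iln|nli|iE].
- by apply: Or32; rewrite i_gt0.
- by apply: Or33; lia.
- apply: Or31; rewrite oddD oi oddb iE.
  by congr (_ ^+ _ * _); lia.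
Qed.

(** For r = s this excludes fixed points; for distinct r and s it says that no orbit is met
    twice. *)
Lemma R8_sig r s : r \in R8 -> s \in R8 -> r != bconj s.
Proof.
move=> rR /imsetP[[i j] /=]; rewrite inE /= => cij ->; apply: contraTneq rR => ->.
have i2n := ltn_ord i; rewrite bconj_nfE //.
case: (posnP i) cij => [->|i_gt0] //; rewrite R8E; last by lia.
have odd2n : odd (2 * n - i) = odd i by lia.
rewrite /R8_cond odd2n oddD oddb; case: ifP => oi; last by lia.
by case: j.
Qed.

Lemma card_R8 : (#|R8| = n + 2 * (n.-1)./2)%N.
Proof.
rewrite card_in_imset; last first.
  move=> [i j] [i' j'] _ _ /= /nf_inj[]; rewrite !modn_small // => /val_inj -> jj.
  by congr (_, _); case: j j' jj => [] [].
(* [g i] counts the admissible j for the exponent i. The minimum in the partial sums appears because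
   even exponents stop contributing at n. *)
pose g i := (if odd i then 1 else (0 < i < n) * 2)%N.
have gE m : (\sum_(i < m) g i = m./2 + 2 * ((minn m n).-1)./2)%N.
  elim: m => [|m IHm]; first by rewrite big_ord0; lia.
  by rewrite big_ord_recr /= IHm /g; case: ifP; lia.
rewrite -sum1_card (eq_bigl (fun p : 'I_(2 * n) * bool => R8_cond p.1 p.2)); last first.
  by move=> p; rewrite inE.
rewrite big_mkcond -(pair_bigA _ (fun (i : 'I_(2 * n)) j => if R8_cond i j then 1 else 0))%N /=.
transitivity (\sum_(i < 2 * n) g i)%N; last first.
  by rewrite gE; lia.
apply: eq_bigr => i _; rewrite big_bool /R8_cond /g; case: (odd i) => //.
by case: (0 < i < n)%N.
Qed.

End V8nGroup.

(** * The three shapes of pairs and the derivations that realise them *)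

Section V8nPairs.
Variables (n : nat) (V : finGroupType) (a b : V) (F : fieldType).
Hypothesis n_gt0 : (0 < n)%N.
Hypothesis presV : V8n_presentation n a b.
Local Notation A := (groupAlg F V).
Local Notation "[ g ]" := (grpE F g).
Local Notation z := (b ^+ 2)%g.
Local Notation bconj := (bconj b).
Local Notation N8 := (N8 a b).
Local Notation R8 := (R8 n a b).

(** This is the element E(m) of the outline. *)
Definition bconj_diff (m : V) : A := [m] - [bconj m].
Definition pair1 m : A * A := (bconj_diff m * [b], 0).
Definition pair2 m : A * A := ([a^-1%g] * bconj_diff m * [b], bconj_diff m).
Definition pair3 m : A * A := (0, bconj_diff m * [b]).

Lemma oppr_pair (x y : A) : - (x, y) = (- x, - y) :> A * A.
Proof. by []. Qed.

Lemma addr_pair (x y x' y' : A) : (x, y) + (x', y') = (x + x', y + y') :> A * A.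
Proof. by []. Qed.

Lemma ad_pair_N8 m : m \in N8 -> (ad [m] [a], ad [m] [b]) = - pair3 m.
Proof.
move=> mN; rewrite /ad -!grpEM (N8C presV mN (a_N8 presV)) subrr.
by rewrite (bconj_mul b) /pair3 mulrBl -!grpEM oppr_pair oppr0 opprB.
Qed.

(** The commutator of a with m b has only the terms a m b and a^-1 m z b. The conjugates introduced
    by [pair1] and [pair2] cancel, as b (a m) b^-1 = a^-1 b (m z) b^-1. *)
Lemma ad_pair_N8b m : m \in N8 ->
  (ad [(m * b)%g] [a], ad [(m * b)%g] [b]) = pair1 (a * m) - pair2 (m * z).
Proof.
move=> mN; have sz : bconj z = z by rewrite bconjX bconjb.
have Nz := z_N8 presV; have Na := a_N8 presV.
have NaV : (a^-1)%g \in N8 by rewrite groupV.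
have smN := bconj_N8 presV mN.
have mba : (m * b * a = a^-1 * (m * z) * b)%g.
  rewrite -mulgA (bconj_mul b) mulgA (bconj_a presV) mulgA (N8C presV mN NaV).
  by rewrite !mulgA.
have sam : (bconj (a * m) = a^-1 * bconj (m * z))%g.
  by rewrite (bconjM b a) (bconjM b m) sz (bconj_a presV) -mulgA (N8C presV Nz smN).
have bmb : (b * (m * b) = bconj (m * z))%g.
  by rewrite mulgA (bconj_mul b) (bconjM b m) sz -mulgA.
have -> : pair1 (a * m) - pair2 (m * z) =
    (bconj_diff (a * m) * [b] - [a^-1%g] * bconj_diff (m * z) * [b], - bconj_diff (m * z)).
  by rewrite /pair1 /pair2 oppr_pair addr_pair sub0r.
rewrite /ad -!grpEM mba bmb; congr (_, _); last by rewrite opprB -mulgA.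
rewrite /bconj_diff sam mulrBr !mulrBl -!grpEM opprB addrA subrK.
by rewrite !mulgA.
Qed.

Lemma EsigN m : m \in N8 -> bconj_diff (bconj m) = - bconj_diff m.
Proof. by move=> mN; rewrite /bconj_diff (bconjK presV) // opprB. Qed.

Lemma Esig0 m : bconj m = m -> bconj_diff m = 0.
Proof. by rewrite /bconj_diff => ->; rewrite subrr. Qed.

Lemma pair1N m : m \in N8 -> pair1 (bconj m) = - pair1 m.
Proof. by move=> mN; rewrite /pair1 EsigN // mulNr oppr_pair oppr0. Qed.

Lemma pair2N m : m \in N8 -> pair2 (bconj m) = - pair2 m.
Proof. by move=> mN; rewrite /pair2 EsigN // mulrN mulNr. Qed.

Lemma pair3N m : m \in N8 -> pair3 (bconj m) = - pair3 m.
Proof. by move=> mN; rewrite /pair3 EsigN // mulNr oppr_pair oppr0. Qed.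

Section Subspace.
(** A linear subspace of pairs: first the pairs realised by some derivation, later those realised by
    a derivation in the span of the candidate basis. *)
Variable Q : A * A -> Prop.
Hypothesis Q0 : Q 0.
Hypothesis QL : forall k p q, Q p -> Q q -> Q (k *: p + q).

Lemma subspaceZ k p : Q p -> Q (k *: p).
Proof. by move=> Qp; rewrite -[_ *: _]addr0; apply: QL. Qed.

Lemma subspaceD p q : Q p -> Q q -> Q (p + q).
Proof. by move=> Qp Qq; rewrite -[p]scale1r; apply: QL. Qed.

Lemma subspaceN p : Q p -> Q (- p).
Proof. by move=> Qp; rewrite -scaleN1r; apply: subspaceZ. Qed.

Lemma subspace_ad :
    (forall m, m \in N8 -> [/\ Q (pair1 m), Q (pair2 m) & Q (pair3 m)]) ->
  forall u, Q (ad u [a], ad u [b]).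
Proof.
move=> QP u; have -> : (ad u [a], ad u [b]) =
    \sum_g u g *: (ad [g] [a], ad [g] [b]) :> A * A.
  have adE x : ad u x = \sum_g u g *: ad [g] x.
    rewrite {1}/ad {1 2}[u]groupAlg_sum mulr_sumr mulr_suml -sumrB.
    by apply: eq_bigr => g _; rewrite -scalerAl -scalerAr scalerBr.
  rewrite [LHS]surjective_pairing [RHS]surjective_pairing !raddf_sum /=.
  by rewrite !adE.
apply: (big_ind Q) => // [p q|g _]; first exact: subspaceD.
apply: subspaceZ; case: (V8n_cosets presV g) => gN.
  by rewrite ad_pair_N8 //; apply: subspaceN; case: (QP g).
rewrite -[g](mulgKV b) ad_pair_N8b //; apply: subspaceD.
  by case: (QP (a * (g * b^-1))%g) => //; rewrite groupM ?(a_N8 presV).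
apply: subspaceN.
by case: (QP (g * b^-1 * z)%g) => //; rewrite groupM ?(z_N8 presV).
Qed.

(** Up to sign, [P] depends only on the orbit, and it vanishes on the fixed points, so its values on
    [R8] decide. *)
Lemma subspace_transversal (P : V -> A * A) :
    (forall m, bconj m = m -> P m = 0) ->
    (forall m, m \in N8 -> P (bconj m) = - P m) ->
    (forall r, r \in R8 -> Q (P r)) ->
  forall m, m \in N8 -> Q (P m).
Proof.
move=> P0 PN PR m mN; have [/P0->//|/PR//|sR] := R8_cover n_gt0 presV mN.
by rewrite -[P m]opprK -PN //; apply: subspaceN; apply: PR.
Qed.

(** The first shape is indexed by the inverses of [R8], to match the signs in the listed pairs; this
    works because inversion commutes with conjugation. *)
Lemma subspace_P :
    (forall r, r \in R8 -> [/\ Q (pair1 r^-1), Q (pair2 r) & Q (pair3 r)]) ->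
  forall m, m \in N8 -> [/\ Q (pair1 m), Q (pair2 m) & Q (pair3 m)].
Proof.
move=> QR m mN; split.
- rewrite -[m]invgK; apply: (subspace_transversal (P := fun m => pair1 m^-1)).
  + by move=> g sg; rewrite /pair1 Esig0 ?mul0r // bconjV sg.
  + by move=> g gN; rewrite -bconjV pair1N // groupV.
  + by move=> r /QR[].
  + by rewrite groupV.
- apply: subspace_transversal mN.
  + by move=> g sg; rewrite /pair2 Esig0 ?mulr0 // mul0r.
  + exact: pair2N.
  + by move=> r /QR[].
- apply: subspace_transversal mN.
  + by move=> g sg; rewrite /pair3 Esig0 ?mul0r.
  + exact: pair3N.
  + by move=> r /QR[].
Qed.

End Subspace.

Hypothesis nz2 : 2%:R != 0 :> F.

Let K (p : A * A) := exists d, d_pair F a b p d.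

Let K0 : K 0. Proof. by exists 0; apply: d_pair0. Qed.

Let KL k p q : K p -> K q -> K (k *: p + q).
Proof. by move=> [d dp] [e eq]; exists (k *: d + e); apply: d_pairD. Qed.

Lemma pair3_exists m : m \in N8 -> K (pair3 m).
Proof.
move=> mN; rewrite -[pair3 m]opprK; apply: subspaceN => //.
by rewrite -ad_pair_N8 //; exists (ad [m]); apply: d_pair_ad.
Qed.

Lemma pair12_exists m : m \in N8 -> K (pair1 (a * m) - pair2 (m * z)).
Proof.
by move=> mN; rewrite -ad_pair_N8b //; exists (ad [(m * b)%g]); apply: d_pair_ad.
Qed.

(* Applying the previous lemma to [m] and to [bconj m] cancels the second family. *)
Lemma pair1_shift m : m \in N8 -> K (pair1 (a * m) - pair1 (a^-1 * z * m)).
Proof.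
move=> mN; have := subspaceD KL (pair12_exists mN) (pair12_exists (bconj_N8 presV mN)).
have sz : bconj z = z by rewrite bconjX bconjb.
have Na := a_N8 presV; have Nz := z_N8 presV.
have azmN : (a^-1 * z * m)%g \in N8.
  by apply: groupM => //; apply: groupM => //; rewrite groupV.
have sazm : (bconj (a^-1 * z * m) = a * bconj m)%g.
  rewrite (bconjM b (a^-1 * z)) (bconjM b a^-1) sz bconjV (bconj_a presV) invMg invgK.
  by rewrite (zV presV) (N8C presV Nz Na) -(mulgA a) (expz2 presV) mulg1.
rewrite -{2}sz -(bconjM b m) (pair2N (groupM mN Nz)) opprK addrACA addNr addr0.
by rewrite -sazm pair1N.
Qed.

(** Induction on the exponent of a in steps of two: [pair1_shift] links a^(i+2) z^j with a^i
    z^(j+1). For i = 0 the pair is zero, as z^j is fixed by conjugation. *)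
Lemma pair1_exists m : m \in N8 -> K (pair1 m).
Proof.
case/(N8P presV) => i [j ->].
have Nz k : (z ^+ k)%g \in N8 by rewrite groupX ?(z_N8 presV).
have szk k : bconj (z ^+ k) = (z ^+ k)%g by rewrite !bconjX bconjb.
have KB p q : K (p - q) -> K q -> K p.
  by move=> Kpq Kq; rewrite -[p](subrK q); apply: subspaceD.
elim/ltn_ind: i j => -[|[|i]] IH j.
- by rewrite expg0 mul1g /pair1 Esig0 ?mul0r.
(* For i = 1 the two elements linked by the shift are conjugate, so the difference of their pairs is
   twice one pair, and 2 is invertible. *)
- have NaV : (a^-1 * z * z ^+ j)%g \in N8.
    by apply: groupM => //; apply: groupM; rewrite ?groupV ?(a_N8 presV) ?(z_N8 presV).
  have sazz : (bconj (a^-1 * z * z ^+ j) = a * z ^+ j)%g.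
    rewrite (bconjM b (a^-1 * z)) (bconjM b a^-1) szk bconjV (bconj_a presV) (szk 1%N).
    rewrite invMg invgK (zV presV) expg1 (N8C presV (Nz 1%N) (a_N8 presV)).
    by rewrite -(mulgA a) (expz2 presV) mulg1.
  have := pair1_shift (Nz j); rewrite -[pair1 (_ * z ^+ j)]opprK -pair1N // sazz opprK.
  rewrite expg1 -mulr2n -scaler_nat => /(subspaceZ K0 KL (2%:R : F)^-1).
  by rewrite scalerA mulVf // scale1r.
have aN := a_N8 presV.
have maN : (a * (a ^+ i * z ^+ j))%g \in N8.
  by apply: groupM => //; apply/(N8P presV); exists i, j.
have e1 : (a ^+ i.+2 * z ^+ j = a * (a * (a ^+ i * z ^+ j)))%g.
  by rewrite !expgS !mulgA.
have e2 : (a^-1 * z * (a * (a ^+ i * z ^+ j)) = a ^+ i * z ^+ j.+1)%g.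
  rewrite mulgA -(mulgA a^-1%g) (N8C presV (Nz 1%N) aN) mulKg expg1 (expgS z j) (mulgA z).
  by rewrite (mulgA (a ^+ i)%g z) (N8C presV (Nz 1%N)) ?groupX.
have := pair1_shift maN; rewrite e1 e2 => /KB; apply; apply: IH.
by [].
Qed.

Lemma pair2_exists m : m \in N8 -> K (pair2 m).
Proof.
move=> mN; have mzN : (m * z)%g \in N8 by rewrite groupM ?(z_N8 presV).
have := pair12_exists mzN; rewrite -mulgA (expz2 presV) mulg1 => K12.
rewrite -[pair2 m]opprK; apply: subspaceN => //.
rewrite -[- _](addKr (pair1 (a * (m * z)))); apply: subspaceD => //.
by apply: subspaceN => //; apply: pair1_exists; rewrite groupM ?(a_N8 presV).
Qed.

End V8nPairs.

(** * A basis of derivations indexed by three copies of [R8] *)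

Section V8nBasis.
Variables (n : nat) (V : finGroupType) (a b : V) (F : fieldType).
Hypothesis n_gt0 : (0 < n)%N.
Hypothesis presV : V8n_presentation n a b.
Local Notation A := (groupAlg F V).
Local Notation "[ g ]" := (grpE F g).
Local Notation z := (b ^+ 2)%g.
Local Notation bconj := (bconj b).
Local Notation N8 := (N8 a b).
Local Notation R8 := (R8 n a b).
Local Notation Esig := (bconj_diff b F).
Local Notation P1 := (pair1 b F).
Local Notation P2 := (pair2 a b F).
Local Notation P3 := (pair3 b F).

(** [option bool] serves as a three-element set of labels for the shapes. *)
Definition fam (t : option bool * V) : A * A :=
  match t with
  | (None, r) => P1 r^-1%g
  | (Some false, r) => P2 r
  | (Some true, r) => P3 r
  end.

(* Coordinate functions dual to [fam]; the correction in the first one removes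
   the contribution of the pairs [P2 r]. *)
Definition fam_dual (t : option bool * V) (p : A * A) : F :=
  match t with
  | (None, r) => (p.1 - [a^-1%g] * p.2 * [b]) (r^-1 * b)%g
  | (Some false, r) => p.2 r
  | (Some true, r) => p.2 (r * b)%g
  end.

Lemma fam_dualD t p q : fam_dual t (p + q) = fam_dual t p + fam_dual t q.
Proof.
case: t => [[[]|] r] /=; [exact: ffunE | exact: ffunE | ].
by rewrite mulrDr mulrDl opprD addrACA ffunE.
Qed.

Lemma fam_dualZ t k p : fam_dual t (k *: p) = k * fam_dual t p.
Proof.
case: t => [[[]|] r] /=; [exact: ffunE | exact: ffunE | ].
by rewrite -scalerAr -scalerAl -scalerBr ffunE.
Qed.

Let R8N r : r \in R8 -> r \in N8.
Proof. exact: (fintype.subsetP (R8_N8 presV)). Qed.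

Lemma EsigE m g : Esig m g = (g == m)%:R - (g == bconj m)%:R.
Proof. by rewrite !ffunE. Qed.

Lemma Esig_out m g : m \in N8 -> g \notin N8 -> Esig m g = 0.
Proof.
move=> mN gN; rewrite EsigE.
have /negPf -> : g != m by apply: contraNneq gN => ->.
have /negPf -> : g != bconj m by apply: contraNneq gN => ->; apply: (bconj_N8 presV).
exact: subrr.
Qed.

Lemma Esig_R8 r s : r \in R8 -> s \in R8 -> Esig s r = (r == s)%:R.
Proof.
by move=> rR sR; rewrite EsigE (negPf (R8_sig n_gt0 presV rR sR)) subr0.
Qed.

Lemma Esig_R8V r s : r \in R8 -> s \in R8 -> Esig s^-1%g r^-1%g = (r == s)%:R.
Proof.
move=> rR sR; rewrite EsigE bconjV !(inj_eq invg_inj).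
by rewrite (negPf (R8_sig n_gt0 presV rR sR)) subr0.
Qed.

Lemma notin_N8_mulb m : m \in N8 -> (m * b)%g \notin N8.
Proof. by move=> mN; rewrite groupMl // (b_notin_N8 n_gt0 presV). Qed.

Lemma notin_N8_mulVb m : m \in N8 -> (m * b^-1)%g \notin N8.
Proof. by move=> mN; rewrite groupMl // groupV (b_notin_N8 n_gt0 presV). Qed.

(** E(s) is supported on [N8] and restricts on [R8] to the indicator of s. Different shapes are
    separated by the cosets [N8] and [N8] b, except the first two, which the correction term
    separates. *)
Lemma fam_dualE t u : t.2 \in R8 -> u.2 \in R8 -> fam_dual t (fam u) = (u == t)%:R.
Proof.
case: t u => [t r] [u s] /= rR sR; have rN := R8N rR; have sN := R8N sR.
rewrite xpair_eqE [s == r]eq_sym; case: t => [[]|]; case: u => [[]|]; rewrite /fam /=.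
- by rewrite grpEMl mulgK Esig_R8.
- by rewrite Esig_out ?notin_N8_mulb.
- by rewrite ffunE.
- by rewrite grpEMl Esig_out ?notin_N8_mulVb.
- by rewrite Esig_R8.
- by rewrite ffunE.
- rewrite sub0r [LHS]ffunE -mulrA grpEMr !grpEMl mulgA mulgK invgK Esig_out ?oppr0 //.
  apply: notin_N8_mulVb.
  by rewrite groupM ?groupV ?(a_N8 presV).
- by rewrite subrr ffunE.
- by rewrite mulr0 mul0r subr0 grpEMl mulgK Esig_R8V.
Qed.

Hypothesis nz2 : 2%:R != 0 :> F.

Let fam_index : {set option bool * V} := [set t | t.2 \in R8]%SET.

Lemma card_fam_index : #|fam_index| = (3 * #|R8|)%N.
Proof.
have -> : fam_index = finset.setX [set: option bool]%SET R8.
  by apply/setP => t; rewrite !inE.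
by rewrite cardsX cardsT card_option card_bool.
Qed.

Lemma fam_inj : {in fam_index &, injective fam}.
Proof.
move=> t u; rewrite !inE => tR uR tu; have := fam_dualE tR tR.
rewrite {1}tu fam_dualE // eqxx; case: eqP => [-> //|_ /esym/eqP].
by rewrite oner_eq0.
Qed.

Lemma fam_exists t : t.2 \in R8 -> exists d, d_pair F a b (fam t) d.
Proof.
case: t => [[[]|] r] /R8N rN.
- exact: (pair3_exists F presV).
- exact: (pair2_exists presV).
- by apply: (pair1_exists presV) => //; rewrite groupV.
Qed.

(** The default 0 is never taken when [t.2] lies in [R8], by [fam_exists]. *)
Definition fam_der (t : option bool * V) : A -> A := xget 0 (d_pair F a b (fam t)).

Lemma fam_derP t : t.2 \in R8 -> d_pair F a b (fam t) (fam_der t).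
Proof. by move=> tR; apply: xgetPex; apply: fam_exists. Qed.

Definition fam_seq := [seq fam_der t | t <- enum fam_index].

Lemma fam_seqP d : reflect
  (exists2 t, t.2 \in R8 & d = fam_der t) (d \in fam_seq).
Proof.
apply: (iffP mapP) => -[t tR ->]; exists t => //.
  by move: tR; rewrite mem_enum inE.
by rewrite mem_enum inE.
Qed.

Lemma fam_seq_uniq : uniq fam_seq.
Proof.
rewrite map_inj_in_uniq ?enum_uniq // => t u; rewrite !mem_enum => tR uR e.
apply: fam_inj => //; move: tR uR; rewrite !inE => /fam_derP dt /fam_derP.
by rewrite -e; apply: d_pair_fun dt.
Qed.

Lemma fam_seq_card : ([set` fam_seq] #= `I_(3 * #|R8|))%card.
Proof.
have <- : size fam_seq = (3 * #|R8|)%N by rewrite size_map -cardE card_fam_index.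
have -> : [set` fam_seq] = nth 0 fam_seq @` `I_(size fam_seq).
  apply/seteqP; split=> [d /= /(nthP 0)[i lti <-]|_ [i /= lti <-]].
    by exists i.
  exact: mem_nth.
apply: inj_card_eq => i j; rewrite !inE /= => lti ltj.
by move/eqP; rewrite nth_uniq ?fam_seq_uniq // => /eqP.
Qed.

Lemma fam_seq_indep : lin_indep [set` fam_seq].
Proof.
apply: lin_indep_dual => _ /= /fam_seqP[t tR ->].
have dE u : u.2 \in R8 -> (fam_der u [a], fam_der u [b]) = fam u.
  by move=> /fam_derP[_ _ -> ->]; case: (fam u).
exists (fun d => fam_dual t (d [a], d [b])); split.
- by move=> d e; rewrite -fam_dualD.
- by move=> k d; rewrite -fam_dualZ.
- by rewrite dE // fam_dualE // eqxx.
move=> _ /fam_seqP[u uR ->] ut; rewrite dE // fam_dualE //.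
by have [ut'|] := eqVneq u t; rewrite // ut' eqxx in ut.
Qed.

Hypothesis algF : algebraic_over_prime_field F.
Hypothesis nzV : #|V|%:R != 0 :> F.

(** The given derivation is some [ad u]. The pairs realised inside the span form a subspace
    containing every [fam t], hence the pair of [ad u]; as a and b generate, [ad u] itself lies in
    the span. *)
Lemma fam_seq_span : Der A `<=` lin_span [set` fam_seq].
Proof.
move=> d dD; have dZ := der_scalable dD algF.
have [u du] := derivation_inner dD dZ nzV.
pose Q p := exists2 e, seq_span fam_seq e & d_pair F a b p e.
have Q0 : Q 0 by exists 0; [exact: seq_span0 | exact: d_pair0].
have QL k p q : Q p -> Q q -> Q (k *: p + q).
  move=> [e es ep] [f fs fq]; exists (k *: e + f); first exact: seq_span_linear.
  exact: d_pairD.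
have Qfam t : t.2 \in R8 -> Q (fam t).
  move=> tR; exists (fam_der t); last exact: fam_derP.
  by apply: seq_span_mem fam_seq_uniq _; apply/fam_seqP; exists t.
have [e es eQ] : Q (ad u [a], ad u [b]).
  apply: (subspace_ad presV Q0 QL); apply: (subspace_P n_gt0 presV Q0 QL) => r rR.
  split; [exact: (Qfam (None, r)) | exact: (Qfam (Some false, r))|].
  exact: (Qfam (Some true, r)).
have [genG _ _] := presV.
by rewrite du (d_pair_inj genG (d_pair_ad a b u) eQ); apply: seq_span_lin.
Qed.

Lemma fam_seq_basis : is_basis (Der A) [set` fam_seq].
Proof.
split; [|exact: fam_seq_indep|exact: fam_seq_span].
by move=> _ /= /fam_seqP[t /fam_derP[dD _ _ _] ->].
Qed.

End V8nBasis.

(** * Matching the family with the explicit lists of pairs *)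

Section V8nListedPairs.
Variables (n : nat) (V : finGroupType) (a b : V) (F : fieldType).
Hypothesis n_gt0 : (0 < n)%N.
Hypothesis presV : V8n_presentation n a b.
Local Notation A := (groupAlg F V).
Local Notation "[ g ]" := (grpE F g).
Local Notation z := (b ^+ 2)%g.
Local Notation R8 := (R8 n a b).
Local Notation Esig := (bconj_diff b F).
Local Notation P1 := (pair1 b F).
Local Notation P2 := (pair2 a b F).
Local Notation P3 := (pair3 b F).

Lemma nfV i j : ((a ^+ i * z ^+ j)^-1 = a ^- i * z ^+ j)%g.
Proof.
rewrite invMg -(expgVn z) (zV presV); apply: (N8C presV).
  by rewrite groupX ?(z_N8 presV).
by rewrite groupV groupX ?(a_N8 presV).
Qed.

Lemma expz_double k : (z ^+ (2 * k) = 1)%g.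
Proof. by rewrite expgM (expz2 presV : z ^+ 2 = 1)%g expg1n. Qed.

Lemma bconj_even k j : bconj b (a ^+ (2 * k) * z ^+ j) = (a ^- (2 * k) * z ^+ j)%g.
Proof. by rewrite (bconj_nf presV) (expgD z (2 * k) j) expz_double mul1g. Qed.

Lemma bconj_odd k : (0 < k)%N ->
  bconj b (a ^+ (2 * k - 1)) = (a ^- (2 * k - 1) * z)%g.
Proof.
move=> k_gt0; have := bconj_nf presV (2 * k - 1) 0.
rewrite expg0 mulg1 => ->; congr (_ * _)%g.
have -> : (2 * k - 1 + 0 = 2 * k.-1 + 1)%N by lia.
by rewrite (expgD z (2 * k.-1)) expz_double mul1g expg1.
Qed.

Lemma Esig_even k j :
  Esig (a ^+ (2 * k) * z ^+ j) = ([a ^+ (2 * k)] - [a ^- (2 * k)]) * [z ^+ j].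
Proof. by rewrite /bconj_diff bconj_even mulrBl -!grpEM. Qed.

Lemma Esig_evenV k j :
  Esig (a ^+ (2 * k) * z ^+ j)^-1 = ([a ^- (2 * k)] - [a ^+ (2 * k)]) * [z ^+ j].
Proof.
by rewrite /bconj_diff bconjV bconj_even -nfV invgK nfV mulrBl -!grpEM.
Qed.

Lemma Esig_odd k : (0 < k)%N ->
  Esig (a ^+ (2 * k - 1)) = [a ^+ (2 * k - 1)] - [a ^- (2 * k - 1)] * [z].
Proof. by move=> k_gt0; rewrite /bconj_diff bconj_odd // -grpEM. Qed.

Lemma Esig_oddV k : (0 < k)%N ->
  Esig (a ^- (2 * k - 1)) = [a ^- (2 * k - 1)] - [a ^+ (2 * k - 1)] * [z].
Proof.
move=> k_gt0; rewrite /bconj_diff bconjV bconj_odd // -grpEM.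
by have := nfV (2 * k - 1) 1; rewrite expg1 => <-; rewrite invgK.
Qed.

Lemma pair1_even k j : P1 (a ^+ (2 * k) * z ^+ j)^-1 =
  (([a ^- (2 * k)] - [a ^+ (2 * k)]) * [z ^+ j * b], 0).
Proof. by rewrite /pair1 Esig_evenV -mulrA -grpEM. Qed.

Lemma pair2_even k j : (0 < k)%N -> P2 (a ^+ (2 * k) * z ^+ j) =
  (([a ^+ (2 * k - 1)] - [a ^- (2 * k + 1)]) * [z ^+ j * b],
   ([a ^+ (2 * k)] - [a ^- (2 * k)]) * [z ^+ j]).
Proof.
move=> k_gt0; rewrite /pair2 Esig_even; congr (_, _).
rewrite -!mulrA -grpEM !mulrA mulrBr -!grpEM.
have -> : (a^-1 * a ^+ (2 * k) = a ^+ (2 * k - 1))%g.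
  by case: k k_gt0 => // k _; rewrite mulnS expgS mulKg add2n subn1.
by rewrite -invMg -expgSr addn1.
Qed.

Lemma pair3_even k j : P3 (a ^+ (2 * k) * z ^+ j) =
  (0, ([a ^+ (2 * k)] - [a ^- (2 * k)]) * [z ^+ j * b]).
Proof. by rewrite /pair3 Esig_even -mulrA -grpEM. Qed.

Lemma pair1_odd k : (0 < k)%N -> P1 (a ^+ (2 * k - 1))^-1 =
  (([a ^- (2 * k - 1)] - [a ^+ (2 * k - 1)] * [z]) * [b], 0).
Proof. by move=> k_gt0; rewrite /pair1 Esig_oddV. Qed.

Lemma mulVa_odd k : (0 < k)%N -> (a^-1 * a ^+ (2 * k - 1) = a ^+ (2 * k - 2))%g.
Proof.
case: k => // k _; rewrite (_ : 2 * k.+1 - 1 = (2 * k.+1 - 2).+1)%N; last by lia.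
by rewrite expgS mulKg.
Qed.

Lemma mulVa_oddV k : (0 < k)%N -> (a^-1 * a ^- (2 * k - 1) = a ^- (2 * k))%g.
Proof. by move=> k_gt0; rewrite -invMg -expgSr; congr (_ ^- _)%g; lia. Qed.

Lemma pair2_odd k : (0 < k)%N -> P2 (a ^+ (2 * k - 1)) =
  (([a ^+ (2 * k - 2)] - [a ^- (2 * k)] * [z]) * [b],
   [a ^+ (2 * k - 1)] - [a ^- (2 * k - 1)] * [z]).
Proof.
move=> k_gt0; rewrite /pair2 Esig_odd //; congr (_ * _, _).
by rewrite mulrBr mulrA -!grpEM mulVa_odd // mulVa_oddV.
Qed.

Lemma pair2_oddV k : (0 < k)%N -> P2 (a ^- (2 * k - 1)) =
  (([a ^- (2 * k)] - [a ^+ (2 * k - 2)] * [z]) * [b],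
   [a ^- (2 * k - 1)] - [a ^+ (2 * k - 1)] * [z]).
Proof.
move=> k_gt0; rewrite /pair2 Esig_oddV //; congr (_ * _, _).
by rewrite mulrBr mulrA -!grpEM mulVa_odd // mulVa_oddV.
Qed.

Lemma pair3_odd k : (0 < k)%N -> P3 (a ^+ (2 * k - 1)) =
  (0, ([a ^+ (2 * k - 1)] - [a ^- (2 * k - 1)] * [z]) * [b]).
Proof. by move=> k_gt0; rewrite /pair3 Esig_odd. Qed.

Lemma pair3_oddV k : (0 < k)%N -> P3 (a ^- (2 * k - 1)) =
  (0, ([a ^- (2 * k - 1)] - [a ^+ (2 * k - 1)] * [z]) * [b]).
Proof. by move=> k_gt0; rewrite /pair3 Esig_oddV. Qed.

Lemma even_R8 k (j : bool) : (1 <= k <= (n - 1)./2)%N ->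
  (a ^+ (2 * k) * z ^+ j)%g \in R8.
Proof.
move=> kn; rewrite (R8E n_gt0 presV); last by lia.
have oddk : odd (2 * k) = false by lia.
by rewrite /R8_cond oddk; lia.
Qed.

Lemma odd_R8 k : (1 <= k <= n)%N -> (a ^+ (2 * k - 1))%g \in R8.
Proof.
move=> kn; rewrite -[(_ ^+ _)%g]mulg1 -(expg0 z) (R8E n_gt0 presV false); last by lia.
have oddk : odd (2 * k - 1) = true by lia.
by rewrite /R8_cond oddk.
Qed.

(** All odd powers of a lie in [R8], and inversion permutes them. *)
Lemma oddV_R8 k : (1 <= k <= n)%N -> (a ^- (2 * k - 1))%g \in R8.
Proof.
move=> kn; rewrite (expaV presV); last by lia.
have -> : (2 * n - (2 * k - 1) = 2 * (n - k + 1) - 1)%N by lia.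
by apply: odd_R8; lia.
Qed.

Lemma R8P r : r \in R8 ->
  (exists k (j : bool), (1 <= k <= (n - 1)./2)%N /\ r = (a ^+ (2 * k) * z ^+ j)%g) \/
  (exists k, (1 <= k <= n)%N /\ r = (a ^+ (2 * k - 1))%g).
Proof.
case/imsetP => -[i j]; rewrite inE /R8_cond /= => cij ->.
have i2n := ltn_ord i; case: ifP cij => oi cij; [right|left].
  exists ((i + 1)./2); split; first by lia.
  case: j cij => // _; rewrite expg0 mulg1; congr (_ ^+ _)%g; lia.
exists (i./2), j; split; first by lia.
by congr (_ ^+ _ * _)%g; lia.
Qed.

(** [B2] takes the smaller odd exponents and [B3] the others, written as negative powers: 2n - (2k -
    1) = 2l - 1 with l = n - k + 1. *)
Lemma odd_cover k : (1 <= k <= n)%N ->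
  (exists l, (1 <= l <= (n + 1)./2)%N /\ (a ^+ (2 * k - 1) = a ^+ (2 * l - 1))%g) \/
  (exists l, (1 <= l <= uphalf (n - 1))%N /\ (a ^+ (2 * k - 1) = a ^- (2 * l - 1))%g).
Proof.
move=> kn; case: (leqP k (n + 1)./2) => kn2; [left|right].
  by exists k; split => //; lia.
exists (n - k + 1)%N; split; first by lia.
by rewrite (expaV presV); [congr (_ ^+ _)%g|]; lia.
Qed.

(** [B1] collects all three shapes at even exponents, [B2] and [B3] together the second and third
    shapes at odd exponents, and [B4] the first shape at odd exponents. *)
Lemma BpairsE p :
  Bpairs F a b n p <-> exists2 t, t.2 \in R8 & p = fam a b F t.
Proof.
have z0b : (z ^+ false * b = b)%g by rewrite expg0 mul1g.
have z1b : (z ^+ true * b = b ^+ 3)%g by rewrite expg1 -expgSr.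
have z0 (x : A) : x * [z ^+ false] = x by rewrite expg0 grpE1 mulr1.
split=> [[[[|]|]|]|].
- case=> k /= kn H; have kR j := even_R8 j kn; have k_gt0 : (0 < k)%N by lia.
  have := (pair1_even k false, pair1_even k true, pair2_even false k_gt0,
           pair2_even true k_gt0, pair3_even k false, pair3_even k true).
  rewrite z0b z1b z0 => PE.
  case: H => [[[[[|]|]|]|]|] ->.
  + by exists (None, a ^+ (2 * k) * z ^+ false)%g; [exact: kR | rewrite /fam PE].
  + by exists (Some false, a ^+ (2 * k) * z ^+ false)%g; [exact: kR | rewrite /fam PE].
  + by exists (None, a ^+ (2 * k) * z ^+ true)%g; [exact: kR | rewrite /fam PE].
  + by exists (Some false, a ^+ (2 * k) * z ^+ true)%g; [exact: kR | rewrite /fam PE].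
  + by exists (Some true, a ^+ (2 * k) * z ^+ false)%g; [exact: kR | rewrite /fam PE].
  + by exists (Some true, a ^+ (2 * k) * z ^+ true)%g; [exact: kR | rewrite /fam PE].
- case=> k /= kn H; have k_gt0 : (0 < k)%N by lia.
  have kR : (a ^+ (2 * k - 1))%g \in R8 by apply: odd_R8; lia.
  case: H => ->.
  + by exists (Some false, a ^+ (2 * k - 1))%g; [exact: kR | rewrite /fam pair2_odd].
  + by exists (Some true, a ^+ (2 * k - 1))%g; [exact: kR | rewrite /fam pair3_odd].
- case=> k /= kn H; have k_gt0 : (0 < k)%N by lia.
  have kR : (a ^- (2 * k - 1))%g \in R8 by apply: oddV_R8; lia.
  case: H => ->.
  + by exists (Some false, a ^- (2 * k - 1))%g; [exact: kR | rewrite /fam pair2_oddV].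
  + by exists (Some true, a ^- (2 * k - 1))%g; [exact: kR | rewrite /fam pair3_oddV].
- case=> k /= kn ->; have k_gt0 : (0 < k)%N by lia.
  have kR : (a ^+ (2 * k - 1))%g \in R8 by apply: odd_R8; lia.
  by exists (None, a ^+ (2 * k - 1))%g; [exact: kR | rewrite /fam pair1_odd].
case=> -[t r] /= /R8P[[k [j [kn ->]]]|[k [kn ->]]] ->.
  have k_gt0 : (0 < k)%N by lia.
  left; left; left; exists k => //.
  case: t => [[]|]; case: j;
    rewrite /fam ?pair1_even ?pair2_even ?pair3_even // ?z0b ?z1b ?z0.
  + by right.
  + by left; right.
  + by do 2!left; right.
  + by do 4!left; right.
  + by do 3!left; right.
  + by do 5!left.
case: t => [t|]; last first.
  by right; exists k => //; rewrite /fam pair1_odd //; lia.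
case: (odd_cover kn) => [[l [ln ->]]|[l [ln ->]]]; have l_gt0 : (0 < l)%N by lia.
  left; left; right; exists l => //.
  by case: t; rewrite /fam ?pair2_odd ?pair3_odd //; [right|left].
left; right; exists l => //.
by case: t; rewrite /fam ?pair2_oddV ?pair3_oddV //; [right|left].
Qed.

End V8nListedPairs.

Theorem corollary3p2 (n : nat) (n_gt0 : (0 < n)%N)
    (V : finGroupType) (a b : V) (presV : V8n_presentation n a b)
    (F : fieldType) (algF : algebraic_over_prime_field F)
    (charF : [pchar F] =i pred0 \/
             exists p : nat, [/\ p \in [pchar F], odd p & coprime p n]) :
  [/\ has_dim (Der (groupAlg F V))
        (if odd n then 3 * (2 * n - 1) else 6 * (n - 1))%N,
      forall p, Bpairs F a b n p -> exists d, d_pair F a b p d &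
      is_basis (Der (groupAlg F V))
        (\bigcup_(p in Bpairs F a b n) d_pair F a b p)].
Proof.
(* An odd prime coprime to n divides no divisor of 16n; this makes both 2 and [#|V|] invertible. *)
have p8 p : p \in [pchar F] -> odd p -> coprime p n ->
    forall m, (m %| 16 * n)%N -> m%:R != 0 :> F.
  move=> pF op cpn m m16; have pr_p := pcharf_prime pF.
  rewrite -(dvdn_pcharf pF); apply/negP => /dvdn_trans/(_ m16).
  rewrite prime_coprime // in cpn.
  rewrite Euclid_dvdM // (negPf cpn) orbF (Euclid_dvdX 2 4 pr_p) andbT.
  by rewrite dvdn_prime2 // => /eqP p2; rewrite p2 in op.
have nz m : (m %| 16 * n)%N -> m%:R != 0 :> F.
  case: charF => [/pcharf0P F0|[p [pF op cpn]]] m16; last exact: (p8 p).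
  by rewrite F0 -lt0n (dvdn_gt0 _ m16) // muln_gt0.
have nz2 : 2%:R != 0 :> F by apply: nz; rewrite dvdn_mulr.
have nzV : #|V|%:R != 0 :> F by apply/nz/(card_V8n_dvd presV).
have BE p := @BpairsE n V a b F n_gt0 presV p; have [genV _ _] := presV.
(* Each listed pair determines its derivation, so the union consists exactly of the chosen ones. *)
have Bder : \bigcup_(p in Bpairs F a b n) d_pair F a b p =
    [set` fam_seq n a b F].
  apply/seteqP; split=> [d [p /BE[t tR ->] dt]|_ /= /fam_seqP[t tR ->]].
    apply/fam_seqP; exists t => //; apply: d_pair_inj genV dt _.
    exact: (fam_derP presV nz2 tR).
  by exists (fam a b F t); [apply/BE; exists t | exact: (fam_derP presV nz2 tR)].
have basis := fam_seq_basis n_gt0 presV nz2 algF nzV.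
split; last by rewrite Bder.
  exists [set` fam_seq n a b F] => //.
  (* The transversal has 2n - 1 elements for odd n and 2n - 2 for even n. *)
  have -> : (if odd n then 3 * (2 * n - 1) else 6 * (n - 1))%N
      = (3 * #|R8 n a b|)%N.
    by rewrite (card_R8 n_gt0 presV); case: ifP; lia.
  refine (fam_seq_card n_gt0 presV nz2).
by move=> p /BE[t tR ->]; exact: (fam_exists presV nz2 tR).
Qed.
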